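(* Let $\Gamma$ be a countable amenable group and let $\mathcal A$ be a finite set. If $\mathcal C\in\mathcal A^\Gamma$ is symbolically tempered repetitive with respect to a Følner exhaustion sequence, then the hull $\Omega_{\mathcal C}$ of $\mathcal C$ is minimal and uniquely ergodic. In particular, if $\Gamma$ has exact polynomial growth with respect to an adapted metric $d_\Gamma$ and if $\mathcal C$ is symbolically linearly repetitive with respect to $d_\Gamma$, then the hull $\Omega_{\mathcal C}$ of $\mathcal C$ is minimal and uniquely ergodic.
   Context: $\Gamma$ is a countable discrete group with identity $e$, and $m_\Gamma$ is counting measure. $\mathcal A$ is a finite (discrete) set, $\mathcal A^\Gamma$ carries the product topology, and $\Gamma$ acts by $(\gamma.\mathcal C)(x)=\mathcal C(\gamma^{-1}x)$. The hull is $\Omega_{\mathcal C}=\overline{\{\gamma.\mathcal C:\gamma\in\Gamma\}}\subseteq\mathcal A^\Gamma$. Minimal: every $\Gamma$-orbit in $\Omega_{\mathcal C}$ is dense; uniquely ergodic: there is exactly one $\Gamma$-invariant Borel probability measure on $\Omega_{\mathcal C}$. For finite $S\subseteq\Gamma$ the $S$-patch of $\mathcal C$ is $\mathcal C|_S$. Patches on $S$ and $T$ are equivalent if there is $\gamma\in\Gamma$ with $\gamma S=T$ and $\mathcal C(\gamma s)=\mathcal C(s)$ for all $s\in S$; equivalence classes are patterns, and $[S]_{\mathcal C}$ is the set of patterns of all patches $\mathcal C|_{\gamma S}$, $\gamma\in\Gamma$. A pattern $p\in[S]_{\mathcal C}$ occurs in a finite set $T$ if there are a representative $\mathcal C|_{xS}$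 of $p$ and $\gamma\in\Gamma$ with $\gamma xS\subseteq T$ and $\mathcal C(\gamma xs)=\mathcal C(xs)$ for all $s\in S$. A Følner exhaustion sequence is a sequence $\mathcal T=(T_m)_{m\in\mathbb N}$ of finite subsets of $\Gamma$ with $m_\Gamma(T_m\triangle KT_m)/m_\Gamma(T_m)\to0$ for every nonempty finite $K\subseteq\Gamma$, $e\in T_m\subsetneq T_{m+1}$ for all $m$, and $\bigcup_mT_m=\Gamma$. Let $\mathcal R^{\mathcal T}_{\mathcal C}(m)\in\mathbb N\cup\{\infty\}$ be the infimum of all $n\in\mathbb N$ such that every $p\in[T_m^{-1}]_{\mathcal C}$ occurs in $\gamma T_n^{-1}$ for all $\gamma\in\Gamma$. $\mathcal C$ is symbolically tempered repetitive with respect to $\mathcal T$ if $\inf_m m_\Gamma(T_m)/m_\Gamma(T_{\mathcal R^{\mathcal T}_{\mathcal C}(m)})>0$ (the infimum being read as $0$ if some $\mathcal R^{\mathcal T}_{\mathcal C}(m)=\infty$). A metric $d_\Gamma$ on the discrete group $\Gamma$ is adapted if it is left-invariant and all its balls are finite. $\Gamma$ has exact polynomial growth with respect to $d_\Gamma$ if there are $C>0$, $q\ge0$ with $\lim_{t\to\infty}m_\Gamma(\{\gamma:d_\Gamma(\gamma,e)<t\})/(Ct^q)=1$. With $B^\Gamma_r(\gamma)=\{x\in\Gamma:d_\Gamma(x,\gamma)\le r\}$ and $B^\Gamma_r=B^\Gamma_r(e)$, $\mathcal C$ is symbolically linearly repetitive with respect to $d_\Gamma$ if there is $C\ge1$ such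 that for all $r\ge1$ every $p\in[B^\Gamma_r]_{\mathcal C}$ occurs in $B^\Gamma_{Cr}(\gamma)$ for all $\gamma\in\Gamma$. *)

(* Defs.v *)
From HB Require Import structures.
From mathcomp Require Import all_boot all_order all_algebra.
From mathcomp Require Import all_classical all_reals all_analysis.

Set Implicit Arguments.
Unset Strict Implicit.
Unset Printing Implicit Defensive.

Import Order.TTheory GRing.Theory Num.Theory.
Import numFieldNormedType.Exports.

Local Open Scope classical_set_scope.
Local Open Scope ring_scope.

Section subsets_of_the_group.
Context {G : groupType}.
Implicit Types (g : G) (S T K : set G).

Definition translate g S : set G := [set (g * s)%g | s in S].

Definition inv_set S : set G := [set (s^-1)%g | s in S].

Definition mul_set K T : set G := [set (k * t)%g | k in K & t in T].

End subsets_of_the_group.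

(* Counting measure as a real number; only meaningful on finite sets. *)
Definition mcard {R : realType} {G : groupType} (S : set G) : R :=
  fine (counting S).

(* Existence of a left-invariant finitely additive probability measure on all
   subsets. *)
Definition amenable (R : realType) (G : groupType) : Prop :=
  exists mu : set G -> R,
    [/\ forall S, 0 <= mu S,
        mu setT = 1,
        forall S T, S `&` T = set0 -> mu (S `|` T) = mu S + mu T
      & forall g S, mu (translate g S) = mu S].

Record folner_exhaustion (R : realType) (G : groupType) (T : nat -> set G)
    : Prop := FolnerExhaustion {
  folner_finite : forall m, finite_set (T m) ;
  folner_cvg : forall K : set G, finite_set K -> K !=set0 ->
    (mcard (T m `+` mul_set K (T m)) / mcard (T m) : R)
      @[m --> \oo] --> (0 : R) ;
  folner_one : forall m, T m 1%g ;
  folner_proper : forall m, T m `<` T m.+1 ;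
  folner_cover : \bigcup_m T m = setT }.

Definition config (G : groupType) (A : finType) : Type :=
  prod_topology (fun _ : G => discrete_topology A).

Section patterns.
Context {G : groupType} {A : finType}.
Variable C : config G A.
Implicit Types (S T : set G).

(* The configuration C being fixed, a patch C|_S is represented by its
   support S, and a pattern by the set of supports of its representatives. *)
Definition patch_equiv S T : Prop :=
  exists g : G, translate g S = T /\ forall s, S s -> C (g * s)%g = C s.

Definition pattern S : set (set G) := [set T | patch_equiv S T].

Definition patterns S : set (set (set G)) :=
  [set pattern (translate g S) | g in [set: G]].

Definition occurs S (p : set (set G)) T : Prop :=
  exists x g : G,
    [/\ p (translate x S), translate (g * x)%g S `<=` T
      & forall s, S s -> C (g * x * s)%g = C (x * s)%g].

End patterns.

Section tempered_repetitivity.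
Context {G : groupType} {A : finType}.
Variables (C : config G A) (T : nat -> set G).

Definition repetitivity_bound (m n : nat) : Prop :=
  forall p, patterns C (inv_set (T m)) p ->
  forall g : G, occurs C (inv_set (T m)) p (translate g (inv_set (T n))).

(* None stands for infinity. *)
Definition repetitivity (m : nat) : option nat :=
  match pselect (exists n, `[< repetitivity_bound m n >]) with
  | left ex => Some (ex_minn ex)
  | right _ => None
  end.

Definition tempered_ratio (R : realType) (m : nat) : R :=
  if repetitivity m is Some n then mcard (T m) / mcard (T n) else 0.

Definition tempered_repetitive (R : realType) : Prop :=
  0 < inf (range (tempered_ratio R)).

End tempered_repetitivity.

Section metrics.
Context {R : realType} {G : groupType}.
Variable d : G -> G -> R.

Record adapted_metric : Prop := AdaptedMetric {
  adapted_eq0 : forall x y, d x y = 0 <-> x = y ;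
  adapted_sym : forall x y, d x y = d y x ;
  adapted_triangle : forall x y z, d x z <= d x y + d y z ;
  adapted_left_invariant : forall g x y, d (g * x)%g (g * y)%g = d x y ;
  adapted_finite : forall x r, finite_set [set y | d y x <= r] }.

Definition exact_polynomial_growth : Prop :=
  exists c q : R, [/\ 0 < c, 0 <= q &
    mcard [set g : G | d g 1%g < t] / (c * t `^ q) @[t --> +oo] --> (1 : R)].

Definition mball (r : R) (g : G) : set G := [set x | d x g <= r].

Definition linearly_repetitive {A : finType} (C : config G A) : Prop :=
  exists2 c : R, 1 <= c & forall r : R, 1 <= r ->
    forall p, patterns C (mball r 1%g) p ->
    forall g : G, occurs C (mball r 1%g) p (mball (c * r) g).

End metrics.

Definition shift_config {G : groupType} {A : finType} (g : G) (C : config G A) :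
  config G A := fun x => C (g^-1 * x)%g.

Definition hull {G : groupType} {A : finType} (C : config G A) :
  set (config G A) := closure (range (fun g => shift_config g C)).

Lemma prod_topology_continuous (T : topologicalType) (I : Type)
    (K : I -> topologicalType) (f : T -> prod_topology K) :
  (forall i, continuous (fun t => f t i)) -> continuous f.
Proof.
move=> cf t; apply/cvg_sup => i B [_ [[U oU <-] Ut] UB].
have := cf i t U (open_nbhs_nbhs (conj oU Ut)).
by apply: (@filterS _ _ (nbhs_filter t)) => s; exact: UB.
Qed.

Section hull_space.
Context {G : groupType} {A : finType}.
Implicit Types (C D : config G A) (g : G).

Lemma shift1 C : shift_config 1%g C = C.
Proof. by apply/funext => x; rewrite /shift_config invg1 mul1g. Qed.

Lemma shiftM g h C : shift_config g (shift_config h C) = shift_config (g * h)%g C.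
Proof. by apply/funext => x; rewrite /shift_config invgM mulgA. Qed.

Lemma hull_self C : hull C C.
Proof. by apply: subset_closure; exists 1%g => //; exact: shift1. Qed.

Lemma shift_continuous g : continuous (shift_config g : config G A -> config G A).
Proof.
apply: (@prod_topology_continuous (config G A) G
  (fun _ => discrete_topology A : topologicalType)) => x.
exact: (@proj_continuous G (fun _ => discrete_topology A : topologicalType)).
Qed.

Lemma hull_shift C g D : hull C D -> hull C (shift_config g D).
Proof.
move=> hD B nB.
have [_ [[h _ <-] Bh]] := hD _ (@shift_continuous g D B nB).
exists (shift_config (g * h)%g C); split; first by exists (g * h)%g.
by rewrite -shiftM.
Qed.

(* The hull as a topological space in its own right, with the subspace
   topology inherited from set_type. *)
Definition hull_type C : Type := set_type (hull C).

HB.instance Definition _ C := Topological.on (hull_type C).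
HB.instance Definition _ C :=
  isPointed.Build (hull_type C) (SigSub (mem_set (@hull_self C))).

Definition hull_act C g (x : hull_type C) : hull_type C :=
  SigSub (mem_set (@hull_shift C g (\val x) (set_valP x))).

Definition hull_borel C : measurableType _ :=
  g_sigma_algebraType (@open (hull_type C)).

Definition minimal_hull C : Prop :=
  forall x : hull_type C, dense (range (fun g => hull_act g x)).

Definition invariant_measure (R : realType) C
    (mu : probability (hull_borel C) R) : Prop :=
  forall g (B : set (hull_borel C)), measurable B ->
    mu (@hull_act C g @^-1` B) = mu B.

(* Uniqueness is required on Borel sets only: the values of a measure on
   non-measurable sets are unconstrained in the library. *)
Definition uniquely_ergodic_hull (R : realType) C : Prop :=
  exists mu : probability (hull_borel C) R, invariant_measure mu /\
    forall nu : probability (hull_borel C) R, invariant_measure nu ->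
      forall B : set (hull_borel C), measurable B -> nu B = mu B.

End hull_space.

(* Main.v *)
Require Import Defs.
From HB Require Import structures.
From mathcomp Require Import all_boot all_order all_algebra finmap.
From mathcomp Require Import all_classical all_reals all_analysis.
From mathcomp Require Import ring lra.

(** Both parts reduce to one property of [C], [proportionally_repetitive C c]:
for every finite [F] there are finite sets [S] and [W] such that [S] is almost
invariant under the inverses of the elements of [F], every [S^-1]-patch of [C]
recurs inside every translate of [W^-1], and [c * #W <= #S], where [c > 0] does
not depend on [F].  Temperedness along a Foelner exhaustion gives it with
[S = T_m] and [W = T_(R(m))]; linear repetitivity under exact polynomial growth
gives it for balls of radii [r] and [L * r], because growth like [t ^ q] makes
the ratio of the two volumes bounded and large balls Foelner.  Balls are treated
directly because a finite group has no strictly increasing exhaustion.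

Minimality is immediate: every point of the hull agrees with a translate of [C]
on [W^-1], hence contains a copy of every patch of [C].

For unique ergodicity it is enough to look at local sets, the clopen sets
decided by finitely many coordinates, and at invariant finitely additive
contents on them.  The key estimate is [icontent_comparison]: any two invariant
contents satisfy [c * nu U <= la U].  Indeed, the average of [nu] over [S] shows
that some point [D] enters [U] at about [nu U * #S] times [t] in [S], and almost
all these visits are read off from the patch of [D] on [S^-1] alone.  This patch
recurs, as a whole, in the [W]-window of every point [E], so every [E] enters
[U] at least [(nu U - e) * #S] times during [W]; integrating against [la] gives
[#W * la U >= (nu U - e) * #S], and [#S >= c * #W].  Copies of the patch may
overlap in any way: the bound uses a single copy in each window.

Given the estimate, [(la - b * nu) / (1 - b)] with [b = c / 2] is again an
invariant content, so the supremum over all pairs of [la U - nu U] is at most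
[1 - b] times itself; hence it vanishes and invariant contents are unique
([icontent_unique]).  Local sets generate the Borel sigma-algebra, so invariant
probability measures are unique.  One exists: an invariant mean on [G], applied
to the visits of the orbit of [C], is an invariant content, and the hull being
compact, every content on the local sets is countably additive and extends. *)

Set Implicit Arguments.
Unset Strict Implicit.
Unset Printing Implicit Defensive.

Import Order.TTheory GRing.Theory Num.Theory.
Import numFieldNormedType.Exports.

Local Open Scope classical_set_scope.
Local Open Scope ring_scope.

(** * Local sets of the hull *)

Section local_sets.
Context {G : groupType} {A : finType}.
Implicit Types (C D E : config G A) (F : set G) (g : G).

Definition agree_on F D E := forall s, F s -> D s = E s.

Lemma nbhs_agree_on F D : finite_set F -> nbhs D (agree_on F D).
Proof.
move=> /finite_fsetP[F' ->].
have -> : agree_on [set` F'] D = \bigcap_(s in [set` F']) [set E | D s = E s].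
  by apply/seteqP; split=> E DE s /= Fs; exact: DE.
have fD := nbhs_filter D; apply: filter_bigI => s _.
apply: (@proj_continuous G
  (fun _ => discrete_topology A : topologicalType) s D).
by rewrite nbhs_principalE.
Qed.

(** The sets containing a cylinder around [C] form a filter, and this filter
converges to [C] coordinatewise, hence in the product topology. *)
Lemma nbhs_config C U : nbhs C U ->
  exists2 F, finite_set F & agree_on F C `<=` U.
Proof.
pose cyl : set_system (config G A) :=
  [set V | exists2 F, finite_set F & agree_on F C `<=` V].
have cylF : Filter cyl.
  split.
  - by exists set0.
  - move=> V W [F fF FV] [F' fF' FW]; exists (F `|` F').
      by rewrite finite_setU.
    move=> E CE; split; [apply: FV|apply: FW] => s Fs; apply: CE.
      by left.
    by right.
  - by move=> V W VW [F fF FV]; exists F => //; exact: subset_trans VW.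
suff : cyl --> C by apply.
apply/cvg_sup => i B [_ [[V oV <-] VC] VB]; exists [set i] => //.
by move=> E CE; apply: VB => /=; rewrite /proj /= -(CE i).
Qed.

(** Points of the hull look, on finite sets, like translates of [C]. *)
Lemma hull_agree_on C D F : hull C D -> finite_set F ->
  exists x, forall s, F s -> D s = C (x * s)%g.
Proof.
move=> hD fF; have [_ [[h _ <-] DF]] := hD _ (nbhs_agree_on D fF).
by exists h^-1%g => s /DF.
Qed.

Definition window C F (U : set (hull_type C)) :=
  forall x y : hull_type C, agree_on F (\val x) (\val y) -> U x -> U y.

Definition local_set C : set (set (hull_type C)) :=
  [set U | exists2 F, finite_set F & window F U].

Lemma local_set0 C : @local_set C set0.
Proof. by exists set0. Qed.

Lemma local_setC C : setC_closed (@local_set C).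
Proof.
move=> U [F fF wU]; exists F => // x y xy nUx Uy.
by apply: nUx; apply: wU Uy => s Fs; rewrite xy.
Qed.

Lemma local_setU C : setU_closed (@local_set C).
Proof.
move=> U V [F fF wU] [F' fF' wV].
exists (F `|` F'); first by rewrite finite_setU.
move=> x y xy [Ux|Vx]; [left|right].
  by apply: wU Ux => s Fs; apply: xy; left.
by apply: wV Vx => s Fs; apply: xy; right.
Qed.

Lemma local_setI C : setI_closed (@local_set C).
Proof.
move=> U V lU lV; rewrite -(setCK U) -(setCK V) -setCU.
by apply/local_setC/local_setU; exact: local_setC.
Qed.

Lemma local_setT C : @local_set C setT.
Proof. by exists set0. Qed.

Lemma local_set_act C g (U : set (hull_type C)) : local_set U ->
  local_set (@hull_act G A C g @^-1` U).
Proof.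
move=> [F fF wU]; exists [set (g^-1 * s)%g | s in F]; first exact: finite_image.
by move=> x y xy; apply: wU => s Fs; apply: xy; exists s.
Qed.

Lemma local_set_open C (U : set (hull_type C)) : local_set U -> open U.
Proof.
move=> [F fF wU]; rewrite openE => x Ux.
have fx := nbhs_filter x.
have := @initial_continuous _ _ (set_val : hull_type C -> config G A) x _
  (nbhs_agree_on (\val x) fF).
by apply: (@filterS _ (nbhs x) fx) => y xy; exact: wU Ux.
Qed.

Lemma hull_actM C g h (x : hull_type C) :
  hull_act g (hull_act h x) = hull_act (g * h)%g x.
Proof. by apply: val_inj => /=; exact: shiftM. Qed.

Lemma hull_act1 C (x : hull_type C) : hull_act 1%g x = x.
Proof. by apply: val_inj => /=; exact: shift1. Qed.

Lemma hull_compact C : compact (hull C).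
Proof.
apply: (@subclosed_compact _ _ setT); first exact: closed_closure.
  have := @tychonoff G (fun _ => discrete_topology A : topologicalType)
    (fun _ => setT)
    (fun _ => @finite_compact (discrete_topology A) setT (@finite_finset A _)).
  by congr compact; apply/seteqP; split.
exact: subsetT.
Qed.

Lemma hull_type_compact C : compact [set: hull_type C].
Proof.
move=> H PH _.
have [|D [hD cD]] := @hull_compact C (set_val @ H) _.
  by rewrite nbhs_simpl; apply: (@filterE _ H _) => x; exact: set_valP.
exists (SigSub (mem_set hD)); split=> // B N HB.
rewrite nbhsE => -[_ [[W oW <-] WD] WN].
have [|_ [[x Bx <-] Wx]] := cD (set_val @` B) W _ (open_nbhs_nbhs (conj oW WD)).
  by rewrite nbhs_simpl; apply: (@filterS _ H _ _ _ _ HB) => x Bx; exists x.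
by exists x; split => //; exact: WN.
Qed.

(** The source of countable additivity: a countable partition of the hull into
local sets has only finitely many nonempty members. *)
Lemma local_set_finite_cover C (U : (set (hull_type C))^nat) :
  (forall i, local_set (U i)) -> \bigcup_i U i = setT ->
  exists n, \bigcup_(i in `I_n) U i = setT.
Proof.
move=> lU cU; have := @hull_type_compact C; rewrite compact_cover.
move=> /(_ _ setT U (fun i _ => local_set_open (lU i))) [|I _ hI].
  by move: cU; rewrite /cover => ->.
exists (\max_(i <- I) i).+1; rewrite -subTset => x _.
have [i /= iI Ux] := hI x Logic.I.
by exists i => //=; rewrite ltnS; exact: leq_bigmax_seq.
Qed.

(** For an exhaustion of [G] by finite sets [F k], an open set [O] is the union
over [k] of its largest subset with window [F k]. *)
Lemma open_local_bigcup C (O : set (hull_type C)) : countable [set: G] ->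
  open O -> exists2 U : (set (hull_type C))^nat,
    forall i, local_set (U i) & O = \bigcup_i U i.
Proof.
move=> /countable_injP[f finj] [W oW <-].
pose F k := [set g : G | (f g < k)%N].
have fF k : finite_set (F k).
  apply: (@finite_preimage _ _ `I_k f) => [|]; last exact: finite_II.
  by move=> x y _ _; apply: finj; exact: mem_set.
exists (fun k => [set x | forall y : hull_type C,
    agree_on (F k) (\val x) (\val y) -> W (\val y)]).
  move=> k; exists (F k) => // x y xy Ox z yz.
  by apply: Ox => s Fs; rewrite xy // yz.
apply/seteqP; split=> [x Wx|x [k _ /(_ x)]]; last exact.
have [S /finite_fsetP[S' ->] SW] := nbhs_config (open_nbhs_nbhs (conj oW Wx)).
exists (\max_(g <- S') f g).+1 => // y xy.
apply: SW => s /= Ss; apply: xy; rewrite /F /= ltnS.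
exact: (@leq_bigmax_seq _ _ xpredT f).
Qed.

End local_sets.

(** * Cardinalities and invariant contents *)

Section finite_cardinality.
Context {G : groupType}.
Implicit Types S T : set G.

Definition fcard S : nat := #|` fset_set S|.

Lemma mcardE (R : realType) S : finite_set S -> mcard S = (fcard S)%:R :> R.
Proof. by move=> fS; rewrite /mcard /counting asboolT. Qed.

Lemma fcard_setI_count S (P : pred G) : finite_set S ->
  fcard (S `&` [set t | P t]) = count P (fset_set S).
Proof.
move=> fS; rewrite -size_filter; apply: perm_size; apply: uniq_perm.
- exact: fset_uniq.
- by rewrite filter_uniq.
- move=> t; rewrite mem_filter.
  have fSP : finite_set (S `&` [set t | P t]) by exact: finite_setIl.
  rewrite (in_fset_set fSP) (in_fset_set fS) in_setI andbC; congr andb.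
  by apply/idP/idP; rewrite inE.
Qed.

Lemma fcard_inj S T (f : G -> G) : finite_set S -> finite_set T ->
  injective f -> (forall s, S s -> T (f s)) -> (fcard S <= fcard T)%N.
Proof.
move=> fS fT finj ST; rewrite /fcard -(size_map f); apply: uniq_leq_size.
  by rewrite map_inj_uniq //; exact: fset_uniq.
move=> _ /mapP[s + ->]; rewrite !in_fset_set // !inE; exact: ST.
Qed.

Lemma fcard_sub S T : finite_set T -> S `<=` T -> (fcard S <= fcard T)%N.
Proof.
move=> fT ST; apply: (@fcard_inj _ _ id) => //; exact: sub_finite_set fT.
Qed.

Lemma fcard_setU S T : finite_set S -> finite_set T ->
  (fcard (S `|` T) <= fcard S + fcard T)%N.
Proof.
by move=> fS fT; rewrite /fcard fset_setU // cardfsU leq_subr.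
Qed.

Lemma fcard_setD S T : finite_set S -> T `<=` S ->
  (fcard (S `\` T) + fcard T)%N = fcard S.
Proof.
move=> fS TS; have fT := sub_finite_set TS fS.
have fTS : (fset_set T `<=` fset_set S)%fset by rewrite -fset_set_sub.
by rewrite /fcard fset_setD // cardfsDS // subnK // fsubset_leq_card.
Qed.

Lemma fcard_gt0 S : finite_set S -> S !=set0 -> (0 < fcard S)%N.
Proof.
move=> fS [s Ss]; rewrite cardfs_gt0; apply/fset0Pn; exists s.
by rewrite in_fset_set ?inE.
Qed.

End finite_cardinality.

Section invariant_contents.
Context {R : realType} {G : groupType} {A : finType} (C : config G A).
Notation X := (hull_type C).

(** Only local sets are constrained, so that [(la - b * nu) / (1 - b)] is again
a content as soon as [b * nu <= la] on these sets; for Borel measures this would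
first require extending the inequality to all Borel sets. *)
Record invariant_content (la : set X -> R) : Prop := InvariantContent {
  icontentT : la setT = 1 ;
  icontent_ge0 : forall U, local_set U -> 0 <= la U ;
  icontentU : forall U V, local_set U -> local_set V -> U `&` V = set0 ->
    la (U `|` V) = la U + la V ;
  icontent_act : forall g U, local_set U ->
    la (@hull_act G A C g @^-1` U) = la U }.

Section one_content.
Variable la : set X -> R.
Hypothesis ila : invariant_content la.

Lemma icontent0 : la set0 = 0.
Proof.
have l0 := @local_set0 _ _ C.
by have := icontentU ila l0 l0; rewrite setI0 setU0 => /(_ erefl); lra.
Qed.

Lemma icontent_split U V : local_set U -> local_set V ->
  la U = la (U `&` V) + la (U `&` ~` V).
Proof.
move=> lU lV; rewrite -(icontentU ila).
- by rewrite -setIUr setUCr setIT.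
- exact: local_setI.
- by apply: local_setI => //; exact: local_setC.
- by rewrite setIACA setICr setI0.
Qed.

Lemma icontentC U : local_set U -> la (~` U) = 1 - la U.
Proof.
move=> lU; have := icontent_split (@local_setT _ _ C) lU.
by rewrite !setTI (icontentT ila); lra.
Qed.

Lemma icontent_le1 U : local_set U -> la U <= 1.
Proof.
move=> lU; have := icontentC lU; have := icontent_ge0 ila (local_setC lU); lra.
Qed.

(** Integration of the inequality [k <= \sum_i 1_(U i)] over [V].  The induction
cuts [V] along the first [U i], on which one of the [k] visits is used up; this
is why [V] is kept general. *)
Lemma icontent_count_le (I : Type) (s : seq I) (U : I -> set X) (k : R) V :
  (forall i, local_set (U i)) -> local_set V ->
  (forall x, V x -> k <= (count (fun i => x \in U i) s)%:R) ->
  k * la V <= \sum_(i <- s) la (V `&` U i).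
Proof.
move=> lU; elim: s k V => [|i s IH] k V lV kV.
  rewrite big_nil; have [->|/set0P[x Vx]] := eqVneq V set0.
    by rewrite icontent0 mulr0.
  by apply: mulr_le0_ge0; [exact: kV Vx|exact: (icontent_ge0 ila)].
rewrite big_cons; have lVi := local_setI lV (lU i).
have lVni := local_setI lV (local_setC (lU i)).
have IH1 : (k - 1) * la (V `&` U i) <= \sum_(j <- s) la (V `&` U i `&` U j).
  apply: IH => // x [Vx Uix]; have := kV x Vx.
  by rewrite /= mem_set //= natrD; lra.
have IH2 : k * la (V `&` ~` U i) <= \sum_(j <- s) la (V `&` ~` U i `&` U j).
  apply: IH => // x [Vx nUix]; have := kV x Vx.
  by rewrite /= memNset.
have -> : \sum_(j <- s) la (V `&` U j) = \sum_(j <- s) la (V `&` U i `&` U j)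
    + \sum_(j <- s) la (V `&` ~` U i `&` U j).
  rewrite -big_split; apply: eq_bigr => j _ /=.
  rewrite (icontent_split (local_setI lV (lU j)) (lU i)).
  by rewrite setIAC [in X in _ + X]setIAC.
by have := icontent_split lV (lU i); nra.
Qed.

(** The number of times [t] of [S] at which the orbit of [x] visits [U]. *)
Definition hits (S : set G) (U : set X) (x : X) : nat :=
  fcard (S `&` [set t | U (hull_act t x)]).

Lemma hitsE S U x : finite_set S ->
  hits S U x = count (fun t => x \in @hull_act G A C t @^-1` U) (fset_set S).
Proof.
move=> fS; rewrite -fcard_setI_count //; congr fcard.
by congr setI; apply/seteqP; split=> t /=; rewrite inE.
Qed.

Lemma icontent_ge_hits S U (k : R) : finite_set S -> local_set U ->
  (forall x, k <= (hits S U x)%:R) -> k <= (fcard S)%:R * la U.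
Proof.
move=> fS lU kS.
have := @icontent_count_le _ (fset_set S) (fun t => @hull_act G A C t @^-1` U) k
  setT (fun t => local_set_act t lU) (@local_setT _ _ C).
rewrite (icontentT ila) mulr1.
under eq_bigr do rewrite setTI (icontent_act ila) //.
rewrite big_const_seq count_predT iter_addr addr0 mulr_natl; apply => x _.
by rewrite -hitsE.
Qed.

(** A point [x] with the most visits works: at every point the complement of [U]
receives at least [#S - hits S U x] visits. *)
Lemma exists_icontent_le_hits S U : finite_set S -> local_set U ->
  exists x, (fcard S)%:R * la U <= (hits S U x)%:R.
Proof.
move=> fS lU.
have hitsC x : (hits S U x + hits S (~` U) x)%N = fcard S.
  rewrite !hitsE // /fcard.
  rewrite -(count_predC (fun t => x \in @hull_act G A C t @^-1` U)).
  congr (_ + _)%N; apply: eq_count => t /=.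
  by rewrite preimage_setC in_setC.
pose P n := `[< exists x, hits S U x = n >].
have exP : exists n, P n.
  by exists (hits S U point); apply/asboolP; exists point.
have ubP n : P n -> (n <= fcard S)%N.
  by move=> /asboolP[x <-]; rewrite -(hitsC x) leq_addr.
have [n /asboolP[x xn] nmax] := ex_maxnP exP ubP.
exists x; rewrite xn.
have := @icontent_ge_hits S (~` U) ((fcard S)%:R - n%:R) fS (local_setC lU).
rewrite icontentC // => /(_ _)/wrap[y|]; last lra.
have := nmax (hits S U y); rewrite -(ler_nat R) -(hitsC y) natrD.
have -> : P (hits S U y) by apply/asboolP; exists y.
by move=> /(_ isT); lra.
Qed.

End one_content.
End invariant_contents.

(** * Proportional repetitivity: minimality and comparison of contents *)

Section repetitivity.
Context {R : realType} {G : groupType} {A : finType}.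
Implicit Types (C D E : config G A) (F S W : set G).

(** For [t] in the core, the window of the event `[t.D] belongs to [U]', where
[U] has window [F], lies in [S^-1]. *)
Definition core F S : set G := [set t | S t /\ forall f, F f -> S (f^-1 * t)%g].

(** The patch of [C] on [x * S^-1] recurs inside [g * W^-1].  The copy sits on
[z * S^-1] with [z = g * u^-1]: in terms of [u] both the inclusion and the
patches are expressed on [S] and [W] themselves, which are the sets of times
over which contents are averaged. *)
Definition patches_recur C S W : Prop :=
  forall x g, exists u, forall s, S s ->
    W (s * u)%g /\ C (g * (s * u)^-1)%g = C (x * s^-1)%g.

Definition proportionally_repetitive C (c : R) : Prop :=
  forall F (e : R), finite_set F -> 0 < e -> exists S W,
    [/\ finite_set S, finite_set W, S !=set0,
      (fcard (S `\` core F S))%:R <= e * (fcard S)%:R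
    & c * (fcard W)%:R <= (fcard S)%:R /\ patches_recur C S W].

Lemma core_neq0 F S (e : R) : finite_set S -> S !=set0 -> e < 1 ->
  (fcard (S `\` core F S))%:R <= e * (fcard S)%:R -> core F S !=set0.
Proof.
move=> fS S0 e1 Se; apply/set0P/negP => /eqP cS.
have := fcard_gt0 fS S0; rewrite -(ltr0n R) => S1.
by move: Se; rewrite cS setD0; nra.
Qed.

(** Recurrence passes from [C] to the hull, as the window [W^-1] of a point of
the hull is also seen in [C]. *)
Lemma hull_patches_recur C S W D h : hull C D -> finite_set W ->
  patches_recur C S W ->
  exists u, forall s, S s -> W (s * u)%g /\ D (s * u)^-1%g = C (h * s^-1)%g.
Proof.
move=> hD fW CSW.
have [|g Dg] := @hull_agree_on _ _ C D (inv_set W) hD.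
  exact: finite_image.
have [u SW] := CSW h g; exists u => s /SW[Wsu <-]; split => //.
by rewrite Dg //; exists (s * u)%g.
Qed.

(** A window [F] of [x] is seen in [C] at some [h]; as the core of [S] is not
empty, it is part of an [S^-1]-patch of [C], which recurs in the orbit of
[D]. *)
Lemma proportionally_repetitive_minimal C c :
  proportionally_repetitive C c -> minimal_hull C.
Proof.
move=> repC D O [x Ox] [V oV VO].
move: Ox; rewrite -VO /= => Vx.
have [F fF FV] := nbhs_config (open_nbhs_nbhs (conj oV Vx)).
have [h xh] := hull_agree_on (set_valP x) fF.
have [|S [W [fS fW S0 Se [_ CSW]]]] := repC F 2^-1 fF; first by lra.
have [|t [St cS]] := @core_neq0 F S 2^-1 fS S0 _ Se; first by lra.
have [u SW] := hull_patches_recur (h * t)%g (set_valP D) fW CSW.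
exists (hull_act (t * u)%g D); split; last by exists (t * u)%g.
apply: FV => f Ff; apply: etrans (xh f Ff) (esym _).
change (\val D ((t * u)^-1 * f)%g = C (h * f)%g).
have [_] := SW _ (cS _ Ff).
by rewrite !invgM invgK !mulgA mulgK.
Qed.

(** The good times are those at which [D] visits [U] for a reason visible in its
[S^-1]-patch; the copy of that patch in the [W]-window of [E] turns a good time
[t] into the visit of [E] at time [t * u]. *)
Lemma icontent_comparison C c (la nu : set (hull_type C) -> R) U :
  0 < c -> proportionally_repetitive C c ->
  invariant_content la -> invariant_content nu -> local_set U ->
  c * nu U <= la U.
Proof.
move=> c0 repC ila inu lU; have [F fF wU] := lU.
suff H e : 0 < e -> c * (nu U - e) <= la U.
  apply/ler_addgt0Pr => e e0.
  have := H (e / c); rewrite divr_gt0 // mulrBr mulrCA divff ?gt_eqF //; lra.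
move=> e0; have [S [W [fS fW S0 Se [cW CSW]]]] := repC F e fF e0.
have [D HD] := exists_icontent_le_hits inu fS lU.
pose good := core F S `&` [set t | U (hull_act t D)].
have fgood : finite_set good.
  by apply: sub_finite_set fS => t [[]].
have Dgood : (hits S U D <= fcard good + fcard (S `\` core F S))%N.
  apply: (@leq_trans (fcard (good `|` (S `\` core F S)))).
    apply: fcard_sub.
      by rewrite finite_setU; split=> //; exact: finite_setD.
    move=> t [St Ut]; have [cSt|ncSt] := pselect (core F S t).
      by left.
    by right.
  by apply: fcard_setU => //; exact: finite_setD.
have [x0 Dx0] : exists x, forall s, S s -> \val D s^-1%g = C (x * s^-1)%g.
  have [|x Dx] := @hull_agree_on _ _ C _ (inv_set S) (set_valP D).
    exact: finite_image.
  by exists x => s Ss; apply: Dx; exists s.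
have goodW : (fcard good)%:R <= (fcard W)%:R * la U.
  apply: icontent_ge_hits => // E; rewrite ler_nat.
  have [u SW] := hull_patches_recur x0 (set_valP E) fW CSW.
  apply: (@fcard_inj _ _ _ (fun t => t * u)%g) => //.
  - exact: finite_setIl.
  - exact: mulIg.
  - move=> t [[St cSt] Ut]; split; first by have [] := SW t St.
    apply: wU Ut => f Ff /=; rewrite /shift_config.
    have Sft := cSt f Ff; have [_] := SW _ Sft.
    by rewrite -Dx0 // !invgM invgK !mulgA.
have := fcard_gt0 fS S0; rewrite -(ltr0n R) => S1.
have la0 := icontent_ge0 ila lU.
move: Dgood; rewrite -(ler_nat R) natrD => Dgood.
rewrite -(ler_pM2l S1).
have : c * ((fcard S)%:R * nu U - e * (fcard S)%:R)
    <= c * ((fcard W)%:R * la U).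
  by rewrite ler_pM2l //; lra.
nra.
Qed.

(** The map [la |-> (la - b * nu) / a] brings a difference [la U - nu U] up by
the factor [1 / a], while such differences are at most [1]. *)
Lemma icontent_unique C c (la nu : set (hull_type C) -> R) U :
  0 < c -> proportionally_repetitive C c ->
  invariant_content la -> invariant_content nu -> local_set U ->
  la U = nu U.
Proof.
move=> c0 repC; suff H (la' nu' : set (hull_type C) -> R) :
    invariant_content la' -> invariant_content nu' -> local_set U ->
    la' U <= nu' U.
  by move=> ila inu lU; apply/eqP; rewrite eq_le !H.
move=> ila inu lU.
have c1 : c <= 1.
  have := icontent_comparison c0 repC ila ila (@local_setT _ _ C).
  by rewrite (icontentT ila) mulr1.
(* Halving [c] keeps [a] positive when [c = 1]. *)
pose b := c / 2; pose a := 1 - b.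
have a0 : 0 < a by rewrite /a /b; lra.
have a1 : a < 1 by rewrite /a /b; lra.
have step k : forall la1 nu1 : set (hull_type C) -> R,
    invariant_content la1 -> invariant_content nu1 ->
    la1 U - nu1 U <= a ^+ k.
  elim: k => [|k IH] la1 nu1 ila1 inu1.
    have := icontent_le1 ila1 lU; have := icontent_ge0 inu1 lU.
    by rewrite expr0; lra.
  pose ka V := (la1 V - b * nu1 V) / a.
  have ika : invariant_content ka.
    split.
    - by rewrite /ka (icontentT ila1) (icontentT inu1) mulr1 divff // gt_eqF.
    - move=> V lV; apply: divr_ge0; last exact: ltW.
      have := icontent_comparison c0 repC ila1 inu1 lV.
      have := mulr_ge0 (ltW c0) (icontent_ge0 inu1 lV); rewrite /b.
      by lra.
    - move=> V V' lV lV' VV'; rewrite /ka.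
      by rewrite (icontentU ila1 lV lV' VV') (icontentU inu1 lV lV' VV'); ring.
    - by move=> g V lV; rewrite /ka (icontent_act ila1) // (icontent_act inu1).
  have := IH _ _ ika inu1; rewrite /ka exprS => IHk.
  have -> : la1 U - nu1 U = a * ((la1 U - b * nu1 U) / a - nu1 U).
    by rewrite mulrBr mulrCA divff ?gt_eqF // /a; ring.
  by rewrite ler_pM2l.
rewrite -subr_le0 leNgt; apply/negP => lt0.
have : a ^+ k @[k --> \oo] --> (0 : R).
  by apply: cvg_expr; rewrite ger0_norm // ltW.
move=> /cvgr_lt/(_ _ lt0)/filter_ex[k]; apply/negP; rewrite -leNgt; exact: step.
Qed.

End repetitivity.

(** * Invariant measures *)

Section local_algebra.
Context {G : groupType} {A : finType} (C : config G A).

Lemma borel_local : countable [set: G] ->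
  <<s @open (hull_type C)>> = <<s @local_set G A C>>.
Proof.
move=> cG; apply/seteqP.
split; apply: smallest_sub; try exact: smallest_sigma_algebra.
  move=> O /(open_local_bigcup cG)[U lU ->].
  by apply: sigma_algebra_bigcup => i; exact: sub_sigma_algebra.
by move=> U /local_set_open oU; exact: sub_sigma_algebra.
Qed.

(** An alias of the hull, so that it can carry the algebra of local sets as its
measurable sets without clashing with the Borel structure. *)
Definition local_algebra : Type := hull_type C.

HB.instance Definition _ := Pointed.on local_algebra.
HB.instance Definition _ := @isAlgebraOfSets.Build default_measure_display
  local_algebra (@local_set G A C) (@local_set0 G A C) (@local_setU G A C)
  (@local_setC G A C).

Context {R : realType} (la : set (hull_type C) -> R).
Hypotheses (la_ge0 : forall U, 0 <= la U) (ila : invariant_content la).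

Definition local_measure (U : set local_algebra) : \bar R := (la U)%:E.

Let local_measure_ge0 U : (0 <= local_measure U)%E.
Proof. by rewrite lee_fin. Qed.

Let local_measure_semi_additive : measure_function.semi_additive local_measure.
Proof.
apply/additive2P; first by rewrite /local_measure (icontent0 ila).
by move=> U V lU lV UV; rewrite /local_measure (icontentU ila).
Qed.

HB.instance Definition _ := isContent.Build default_measure_display
  local_algebra R local_measure local_measure_ge0 local_measure_semi_additive.

(** By compactness a disjoint union of local sets that is local is a finite
union, and the sums are eventually constant. *)
Let local_measure_semi_sigma_additive : semi_sigma_additive local_measure.
Proof.
move=> F lF tF lUF.
pose V i := if i is j.+1 then F j else ~` \bigcup_j F j.
have [[|j]||n Vn] := @local_set_finite_cover _ _ C V.
- exact: local_setC.
- exact: lF.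
- rewrite -subTset => x _; have [[j _ Fjx]|nFx] := pselect ((\bigcup_j F j) x).
    by exists j.+1.
  by exists 0%N.
have FE k : (n <= k)%N -> \bigcup_i F i = \big[setU/set0]_(i < k) F i.
  move=> nk; rewrite -bigcup_mkord; apply/seteqP.
  split=> [x Fx|x [i _ Fix]]; last by exists i.
  have : [set: hull_type C] x by [].
  rewrite -Vn => -[[_ /(_ Fx)//|i] /= ik Fix].
  by exists i => //=; exact: leq_trans (ltnW ik) nk.
apply: cvg_near_cst; exists n => // k /= nk.
by rewrite (FE k nk) big_mkord measure_bigsetU.
Qed.

HB.instance Definition _ := Content_isMeasure.Build default_measure_display
  local_algebra R local_measure local_measure_semi_sigma_additive.


(** Invariance is checked on the outer measure, where a cover of [U] by local
sets pulls back to a cover of the preimage of [U] of the same total mass. *)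
Lemma local_mu_ext_act_le g (U : set (hull_type C)) :
  (mu_ext local_measure (@hull_act G A C g @^-1` U)
    <= mu_ext local_measure U)%E.
Proof.
apply: le_ereal_inf_tmp => _ [F [lF UF] <-]; apply: ereal_inf_lbound.
exists (fun k => @hull_act G A C g @^-1` F k).
  split=> [k|x Ux]; first exact: local_set_act (lF k).
  by have [k _ Fk] := UF _ Ux; exists k.
apply: eq_eseriesr => k _.
by rewrite /local_measure (icontent_act ila _ (lF k)).
Qed.

Lemma local_mu_ext_act g (U : set (hull_type C)) :
  mu_ext local_measure (@hull_act G A C g @^-1` U) = mu_ext local_measure U.
Proof.
apply/eqP; rewrite eq_le local_mu_ext_act_le /=.
have := local_mu_ext_act_le g^-1%g (@hull_act G A C g @^-1` U).
congr (mu_ext _ _ <= _)%E; apply/seteqP; split=> x /=;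
  by rewrite hull_actM mulgV hull_act1.
Qed.

Hypothesis countG : countable [set: G].

Let borel_measure : set (hull_borel C) -> \bar R :=
  measure_extension local_measure.

Let borel_measure0 : borel_measure set0 = 0%E.
Proof. exact: (measure0 (measure_extension local_measure)). Qed.

Let borel_measure_ge0 U : (0 <= borel_measure U)%E.
Proof. exact: (measure_ge0 (measure_extension local_measure)). Qed.

Let borel_measure_semi_sigma_additive : semi_sigma_additive borel_measure.
Proof.
move=> F mF tF mUF.
apply: (@measure_semi_sigma_additive _ _ _
  (measure_extension local_measure)) => //.
  by move=> i; have := mF i; rewrite /measurable /= borel_local.
by move: mUF; rewrite /measurable /= borel_local.
Qed.

HB.instance Definition _ := isMeasure.Build _ (hull_borel C) R borel_measure
  borel_measure0 borel_measure_ge0 borel_measure_semi_sigma_additive.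

Let borel_measureT : borel_measure setT = 1%E.
Proof.
rewrite /borel_measure /measure_extension measurable_mu_extE /=.
  by rewrite /local_measure (icontentT ila).
exact: local_setT.
Qed.

HB.instance Definition _ := Measure_isProbability.Build _ (hull_borel C) R
  borel_measure borel_measureT.

Lemma icontent_extension :
  exists mu : probability (hull_borel C) R, invariant_measure mu.
Proof.
by exists borel_measure => g B mB; exact: local_mu_ext_act.
Qed.

End local_algebra.

Section uniqueness.
Context {R : realType} {G : groupType} {A : finType} (C : config G A).
Hypothesis countG : countable [set: G].

Lemma local_set_borel (U : set (hull_borel C)) :
  @local_set G A C U -> measurable U.
Proof. by move=> /local_set_open oU; exact: sub_sigma_algebra. Qed.

Lemma probability_icontent (mu : probability (hull_borel C) R) :
  invariant_measure mu ->
  invariant_content (fun U : set (hull_type C) => fine (mu U)).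
Proof.
move=> imu; split.
- by rewrite probability_setT.
- by move=> U _; rewrite fine_ge0.
- move=> U V /local_set_borel mU /local_set_borel mV UV.
  by rewrite measureU // fineD // fin_num_measure.
- by move=> g U /local_set_borel mU; rewrite imu.
Qed.

Lemma probability_eq_local (mu nu : probability (hull_borel C) R) :
  (forall U : set (hull_borel C), @local_set G A C U -> mu U = nu U) ->
  forall B : set (hull_borel C), measurable B -> mu B = nu B.
Proof.
move=> munu B mB.
apply: (@measure_unique _ R (hull_borel C) (@local_set G A C) (fun=> setT)
  (borel_local C countG)) => //.
- exact: local_setI.
- by move=> _; exact: local_setT.
- by rewrite bigcup_const //; exists 0%N.
- by move=> _; apply: le_lt_trans (probability_le1 mu measurableT) (ltry _).
Qed.

(** The mean of the set of times at which the orbit of [C] visits [U]. *)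
Lemma amenable_icontent : amenable R G ->
  exists2 la : set (hull_type C) -> R,
    forall U, 0 <= la U & invariant_content la.
Proof.
move=> [m [m0 mT mU mg]].
exists (fun U => m [set g | U (hull_act g point)]) => //; split=> //.
- move=> U V _ _ UV; rewrite -mU //.
  apply/seteqP; split=> // g [Ug Vg].
  by have : (U `&` V) (hull_act g point) by []; rewrite UV.
- move=> g U _; rewrite -(mg g).
  congr m; apply/seteqP; split=> [_ [h Uh <-]|h Uh] /=.
    by rewrite -hull_actM.
  exists (g^-1 * h)%g; rewrite ?mulgA ?mulgV ?mul1g //=.
  by rewrite hull_actM mulgA mulgV mul1g.
Qed.

Lemma proportionally_repetitive_hull (c : R) : amenable R G -> 0 < c ->
  proportionally_repetitive C c ->
  minimal_hull C /\ uniquely_ergodic_hull R C.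
Proof.
move=> amG c0 repC; split; first exact: proportionally_repetitive_minimal repC.
have [la la0 ila] := amenable_icontent amG.
have [mu imu] := icontent_extension la0 ila countG.
exists mu; split=> // nu inu; apply: probability_eq_local => U lU.
have /local_set_borel mU := lU.
rewrite -(fineK (fin_num_measure nu _ mU)) -(fineK (fin_num_measure mu _ mU)).
congr EFin.
exact: icontent_unique c0 repC (probability_icontent inu)
  (probability_icontent imu) lU.
Qed.

End uniqueness.

(** * Tempered repetitivity *)

Section folner.
Context {R : realType} {G : groupType} {A : finType}.
Implicit Types (C : config G A) (F S W T : set G).

(** A pattern only remembers supports, so the representative [y * S^-1] found in
the window may be matched with [x * S^-1] through [a] with [a * x <> y], when
[S^-1] has a nontrivial left stabilizer; the copy of the patch on [x * S^-1] is
then the one on [k * a * x * S^-1]. *)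
Lemma occurs_patches_recur C S W :
  (forall p, patterns C (inv_set S) p ->
    forall g, occurs C (inv_set S) p (translate g (inv_set W))) ->
  patches_recur C S W.
Proof.
move=> occ x g; have [|y [k [[a [axy Ca]] kyW Ck]]] :=
  occ (pattern C (translate x (inv_set S))) _ g; first by exists x.
exists ((k * a * x)^-1 * g)%g => s Ss.
have [_ [s' Ss' <-] axs] : translate y (inv_set S) (a * (x * s^-1))%g.
  rewrite -axy; exists (x * s^-1)%g => //.
  by exists s^-1%g => //; exists s.
have kaxs : (k * a * x * s^-1 = k * y * s'^-1)%g.
  by rewrite -!mulgA -axs.
have [|_ [w Ww <-] gw] := kyW (k * y * s'^-1)%g.
  by exists s'^-1%g => //; exists s'.
have -> : (s * ((k * a * x)^-1 * g) = w)%g.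
  apply: (mulIg g^-1%g); apply: invg_inj.
  by rewrite mulgA mulgK invgM invgK kaxs -gw invgM invgK.
split=> //; rewrite gw Ck; last by exists s'.
rewrite axs Ca //; exists s^-1%g => //; by exists s.
Qed.

(** A time outside the core is pushed out of [S] by one of the inverses of the
elements of [s]. *)
Lemma fcard_setD_core (s : seq G) S (N : nat) : finite_set S ->
  (forall f, f \in s -> (fcard (S `&` [set t | ~ S (f^-1 * t)%g]) <= N)%N) ->
  (fcard (S `\` core [set` s] S) <= size s * N)%N.
Proof.
move=> fS; elim: s => [|f s IH] sN.
  rewrite (_ : _ `\` _ = set0) ?/fcard ?fset_set0 //.
  by rewrite -subset0 => t [St []].
rewrite /= mulSn; apply: leq_trans (leq_add (sN f _) (IH _)).
- apply: leq_trans (fcard_setU _ _); [apply: fcard_sub| |].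
  + by rewrite finite_setU; split; [exact: finite_setIl|exact: finite_setD].
  + move=> t [St nct].
    have [Sft|nSft] := pselect (S (f^-1 * t)%g); [right|by left].
    split=> // -[_ ct]; apply: nct; split=> // h /=.
    by rewrite inE => /predU1P[->//|]; exact: ct.
  + exact: finite_setIl.
  + exact: finite_setD.
- by rewrite inE eqxx.
- by move=> h hs; apply: sN; rewrite inE hs orbT.
Qed.

Lemma folner_core (T : nat -> set G) F (e : R) : folner_exhaustion R T ->
  finite_set F -> 0 < e -> exists m,
  (fcard (T m `\` core F (T m)))%:R <= e * (fcard (T m))%:R.
Proof.
move=> folT /finite_fsetP[F' ->] e0.
have T0 m : (0 : R) < (fcard (T m))%:R.
  rewrite ltr0n fcard_gt0 //; first exact: (folner_finite folT).
  by exists 1%g; exact: (folner_one folT).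
pose K := 1%g |` inv_set [set` F'].
have fK : finite_set K by rewrite finite_setU; split=> //; exact: finite_image.
have eF : 0 < e / (size F').+1%:R by rewrite divr_gt0 // ltr0n.
have := folner_cvg folT fK (ex_intro _ 1%g (or_introl erefl)).
move=> /cvgr_lt/(_ _ eF)/filter_ex[m mF]; exists m.
have fT := folner_finite folT m.
have fD : finite_set (T m `+` mul_set K (T m)).
  have fKT : finite_set (mul_set K (T m)) by exact: finite_image2.
  by rewrite setY_def finite_setU; split; exact: finite_setD.
move: mF; rewrite !mcardE // ltr_pdivrMr // => mF.
have := @fcard_setD_core F' (T m) (fcard (T m `+` mul_set K (T m))) fT.
move=> /(_ _)/wrap[f fF'|].
  apply: (@fcard_inj _ _ _ (fun t => f^-1 * t)%g) => //.
  - exact: finite_setIl.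
  - exact: mulgI.
  - move=> t [Tt nTt]; right; split=> //.
    by exists f^-1%g; [right; exists f|exists t].
rewrite -(ler_nat R) natrM => /le_trans; apply.
have F1 : (0 : R) < (size F').+1%:R by rewrite ltr0n.
move: mF; rewrite mulrAC ltr_pdivlMr // -natr1 => mF.
have := ler0n R (fcard (T m `+` mul_set K (T m))); nra.
Qed.

Lemma tempered_proportionally_repetitive C (T : nat -> set G) :
  folner_exhaustion R T -> tempered_repetitive C T R ->
  proportionally_repetitive C (inf (range (tempered_ratio C T R))).
Proof.
move=> folT; rewrite /tempered_repetitive; set c := inf _ => c0 F e fF e0.
have [m Tm] := folner_core folT fF e0.
have cm : c <= tempered_ratio C T R m.
  apply: ge_inf; last by exists m.
  exists 0 => _ [k _ <-]; rewrite /tempered_ratio; case: repetitivity => // n.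
  by rewrite !mcardE ?divr_ge0 //; exact: (folner_finite folT).
move: cm; rewrite /tempered_ratio /repetitivity.
case: pselect => [ex|_]; last by rewrite leNgt c0.
case: ex_minnP => n /asboolP bn _ cn.
have fT k := folner_finite folT k.
have T1 k : T k !=set0 by exists 1%g; exact: (folner_one folT).
exists (T m), (T n); split=> //; split; last exact: occurs_patches_recur.
move: cn; rewrite !mcardE // ler_pdivlMr //.
by rewrite ltr0n fcard_gt0.
Qed.

End folner.

(** * Polynomial growth *)

Section polynomial_growth.
Context {R : realType} {G : groupType} (d : G -> G -> R).
Hypothesis dA : adapted_metric d.

Lemma adapted_ge0 x y : 0 <= d x y.
Proof.
have := adapted_triangle dA x y x; rewrite (adapted_sym dA y x).
by have /(adapted_eq0 dA) -> : x = x by []; lra.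
Qed.

Lemma adapted_inv x : d x^-1%g 1%g = d x 1%g.
Proof.
by rewrite -(adapted_left_invariant dA x) mulgV mulg1 (adapted_sym dA).
Qed.

Lemma inv_set_mball r : inv_set (mball d r 1%g) = mball d r 1%g.
Proof.
apply/seteqP; split=> [_ [x xr <-]|x xr].
  by rewrite /mball /= adapted_inv.
by exists x^-1%g; rewrite ?invgK // /mball /= adapted_inv.
Qed.

Lemma translate_mball g r : translate g (mball d r 1%g) = mball d r g.
Proof.
apply/seteqP; split=> [_ [x xr <-]|x xr].
  by rewrite /mball /= -{2}(mulg1 g) (adapted_left_invariant dA).
exists (g^-1 * x)%g; last by rewrite mulgA mulgV mul1g.
by rewrite /mball /= -(adapted_left_invariant dA g) mulgA mulgV mul1g mulg1.
Qed.

Lemma finite_mball r g : finite_set (mball d r g).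
Proof. exact: adapted_finite. Qed.

Lemma mball_sub_core (F : set G) (k r : R) : 0 <= k ->
  (forall f, F f -> d f 1%g <= k) ->
  mball d (r - k) 1%g `<=` core F (mball d r 1%g).
Proof.
move=> k0 Fk t; rewrite /mball /= => tr; split=> [|f Ff] /=; first by lra.
have := adapted_triangle dA (f^-1 * t)%g f^-1%g 1%g.
rewrite adapted_inv -{3}(mulg1 f^-1%g) (adapted_left_invariant dA).
by have := Fk f Ff; lra.
Qed.

Lemma finite_set_radius (F : set G) : finite_set F ->
  exists2 k : R, 0 <= k & forall f, F f -> d f 1%g <= k.
Proof.
move=> /finite_fsetP[F' ->]; exists (\sum_(f <- F') d f 1%g).
  by apply: sumr_ge0 => f _; exact: adapted_ge0.
move=> f /= fF; rewrite (big_rem f) //= lerDl.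
by apply: sumr_ge0 => h _; exact: adapted_ge0.
Qed.

Variables (c q : R).
Hypotheses (c0 : 0 < c) (q0 : 0 <= q).
Hypothesis growth :
  mcard [set g : G | d g 1%g < t] / (c * t `^ q) @[t --> +oo] --> (1 : R).

Notation b r := ((fcard (mball d r 1%g))%:R : R).

(** Closed balls lie between the open balls of radii [r] and [r + 1], whence the
shift of the radius in the upper bound. *)
Lemma mball_growth (h : R) : 0 < h -> exists M : R, forall r, M < r ->
  (1 - h) * (c * r `^ q) <= b r /\ b r <= (1 + h) * (c * (r + 1) `^ q).
Proof.
move=> h0.
have fo t : finite_set [set g : G | d g 1%g < t].
  by apply: sub_finite_set (finite_mball t 1%g) => g /= /ltW.
have near_h : \forall t \near +oo, 1 - h <
    mcard [set g : G | d g 1%g < t] / (c * t `^ q) < 1 + h.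
  near=> t; apply/andP; split; near: t.
    by apply: (cvgr_gt _ growth); lra.
  by apply: (cvgr_lt _ growth); lra.
have [M [_ HM]] := near_h.
exists (Num.max M 0) => r; rewrite gt_max => /andP[Mr r0].
have cpos t : 0 < t -> 0 < c * t `^ q.
  by move=> t0; apply: mulr_gt0 => //; exact: powR_gt0.
have r1 : 0 < r + 1 by lra.
have Mr1 : M < r + 1 by lra.
have /andP[+ _] := HM _ Mr; have /andP[_ +] := HM _ Mr1.
rewrite !mcardE // ltr_pdivrMr ?ltr_pdivlMr ?cpos // => ub lb; split.
  apply: le_trans (ltW lb) _; rewrite ler_nat.
  by apply: fcard_sub; [exact: finite_mball|move=> g /= /ltW].
apply: le_trans (ltW ub); rewrite ler_nat.
by apply: fcard_sub => // g; rewrite /mball /=; lra.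
Unshelve. all: by end_near. Qed.

Lemma mball_doubling (L : R) : 1 <= L -> exists M : R, forall r, M < r ->
  (3 * (L + 1) `^ q)^-1 * b (L * r) <= b r.
Proof.
move=> L1; have [|M HM] := @mball_growth 2^-1; first by lra.
exists (Num.max M 1) => r; rewrite gt_max => /andP[Mr r1].
have Lr : M < L * r by nra.
have [lb _] := HM _ Mr; have [_ ub] := HM _ Lr.
have Lq : 0 < 3 * (L + 1) `^ q by rewrite mulr_gt0 ?powR_gt0 //; lra.
rewrite mulrC ler_pdivrMr //; apply: le_trans ub _.
have LrL : (L * r + 1) `^ q <= (L + 1) `^ q * r `^ q.
  rewrite -powRM; [|lra|lra].
  by apply: ge0_ler_powR; rewrite ?nnegrE //; nra.
have Lq' : 0 < (L + 1) `^ q by rewrite powR_gt0 //; lra.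
have rq : 0 < r `^ q by rewrite powR_gt0 //; lra.
apply: (@le_trans _ _ ((1 + 2^-1) * (c * ((L + 1) `^ q * r `^ q)))).
  by rewrite ler_pM2l ?ler_pM2l //; lra.
have := ler_wpM2l (ltW Lq) lb; nra.
Qed.

Lemma powR_near1 (h : R) : 0 < h ->
  exists2 e : R, 0 < e & forall x, `|1 - x| < e -> 1 - h < x `^ q.
Proof.
move=> h0; have cq : {for 1, continuous (fun x : R => x `^ q)}.
  apply: differentiable_continuous; apply/derivable1_diffP.
  by apply: derivable_powR; rewrite in_itv /= ltr01.
have : \forall x \near (1 : R), 1 - h < x `^ q.
  by apply: (cvgr_gt _ cq); rewrite powR1; lra.
by move=> /nbhs_ballP[e /= e0 He]; exists e => // x xe; exact: He.
Qed.

(** The shell between the radii [r - k] and [r] is negligible because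
[((r - k) / (r + 1)) ^ q] tends to [1]. *)
Lemma mball_folner (k e : R) : 0 <= k -> 0 < e ->
  exists M : R, forall r, M < r -> b r - b (r - k) <= e * b r.
Proof.
move=> k0 e0; pose h := Num.min e 1 / 4.
(* With this [h], [(1 - e) * (1 + h) <= (1 - h) ^ 2]. *)
have [h0 h1 he] : [/\ 0 < h, h <= 4^-1 & 3 * h <= e].
  by rewrite /h; case: (leP e 1) => ?; split; lra.
have [M HM] := mball_growth h0; have [z z0 Hz] := powR_near1 h0.
exists (Num.max (M + k) (Num.max k ((k + 1) / z))) => r.
rewrite !gt_max => /and3P[Mr kr zr].
have Mr0 : M < r by lra.
have Mrk : M < r - k by lra.
have [_ ub] := HM _ Mr0; have [lb _] := HM _ Mrk.
pose x := (r - k) / (r + 1).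
have r1 : 0 < r + 1 by lra.
have xz : 1 - h < x `^ q.
  apply: Hz; have -> : 1 - x = (k + 1) / (r + 1) by rewrite /x; field; lra.
  rewrite ger0_norm; last by apply: divr_ge0; lra.
  by move: zr; rewrite ltr_pdivrMr // ltr_pdivrMr //; nra.
have rkq : (r - k) `^ q = x `^ q * (r + 1) `^ q.
  rewrite -powRM; [|by apply: divr_ge0; lra|lra].
  by congr powR; rewrite /x; field; lra.
have rq : 0 < c * (r + 1) `^ q by rewrite mulr_gt0 // powR_gt0.
have {lb} lb : (1 - h) * ((1 - h) * (c * (r + 1) `^ q)) <= b (r - k).
  apply: le_trans lb; rewrite rkq ler_pM2l; last by lra.
  by rewrite [leRHS]mulrCA ler_pM2r // ltW.
set y := c * _ in ub lb rq; set u := b r in ub *; set v := b (r - k) in lb *.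
suff : (1 - e) * u <= v by lra.
have u0 : 0 <= u by exact: ler0n.
have [e1|e1] := leP 1 e.
  by apply: le_trans (ler0n _ _); nra.
apply: le_trans lb; apply: (@le_trans _ _ ((1 - e) * ((1 + h) * y))).
  by rewrite ler_pM2l //; lra.
rewrite [leLHS]mulrA [leRHS]mulrA ler_pM2r //.
have := mulr_gt0 h0 e0; have := mulr_gt0 h0 h0; lra.
Qed.

End polynomial_growth.

Lemma linearly_repetitive_proportionally_repetitive (R : realType)
    (G : groupType) (A : finType) (C : config G A) (d : G -> G -> R) :
  adapted_metric d -> exact_polynomial_growth d -> linearly_repetitive d C ->
  exists2 c : R, 0 < c & proportionally_repetitive C c.
Proof.
move=> dA [c [q [c0 q0 growth]]] [L L1 rep].
have [M1 doubling] := mball_doubling dA c0 q0 growth L1.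
exists (3 * (L + 1) `^ q)^-1.
  by rewrite invr_gt0 mulr_gt0 ?powR_gt0 //; lra.
move=> F e fF e0; have [k k0 Fk] := finite_set_radius dA fF.
have [M2 folner] := mball_folner dA c0 growth k0 e0.
have [r [r1 M1r M2r]] : exists r, [/\ 1 <= r, M1 < r & M2 < r].
  exists (`|M1| + `|M2| + 1); have := ler_norm M1; have := ler_norm M2.
  by have := normr_ge0 M1; have := normr_ge0 M2; split; lra.
exists (mball d r 1%g), (mball d (L * r) 1%g); split=> //.
- exact: finite_mball.
- exact: finite_mball.
- exists 1%g; rewrite /mball /=.
  by have /(adapted_eq0 dA) -> : 1%g = 1%g :> G by []; lra.
- apply: le_trans (folner r M2r).
  have fr := finite_mball dA r 1%g; have rk := mball_sub_core dA (r := r) k0 Fk.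
  rewrite lerBrDr -natrD ler_nat.
  have rkr : mball d (r - k) 1%g `<=` mball d r 1%g by move=> t /rk[].
  rewrite -(fcard_setD fr rkr) leq_add2r.
  by apply: fcard_sub; [exact: finite_setD|exact: setDS].
- split; first exact: doubling.
  apply: occurs_patches_recur => p; rewrite !inv_set_mball // => pC g.
  by rewrite translate_mball //; exact: rep.
Qed.

Theorem theorem1p4 (R : realType) (G : groupType) (A : finType)
    (C : config G A) :
  countable [set: G] -> amenable R G ->
  (forall T : nat -> set G,
     folner_exhaustion R T -> tempered_repetitive C T R ->
     minimal_hull C /\ uniquely_ergodic_hull R C) /\
  (forall d : G -> G -> R,
     adapted_metric d -> exact_polynomial_growth d ->
     linearly_repetitive d C ->
     minimal_hull C /\ uniquely_ergodic_hull R C).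
Proof.
move=> countG amG; split=> [T folT tempT|d dA growth linC].
  have repC := tempered_proportionally_repetitive folT tempT.
  exact: (proportionally_repetitive_hull countG amG tempT repC).
have [c c0 repC] :=
  linearly_repetitive_proportionally_repetitive dA growth linC.
exact: (proportionally_repetitive_hull countG amG c0 repC).
Qed.
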